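(* Let $0\le\zeta^{in}\in L^1_{0,1}$, let $\varphi\in L^1_{0,1}$, and let $\mathcal{A}:\mathbb{R}_{>0}^3\to[0,\infty)$ be a measurable function with $\mathcal{A}(x,y;z)=0$ whenever $z>x$. Assume that for some constant $A\ge0$, $\mathcal{A}(x,y;z)\le A\,\varphi(z)$ if $x+y<1$ and $\mathcal{A}(x,y;z)\le A\,(x+y)\,\varphi(z)$ if $x+y>1$. Then every weak solution $\zeta$ (in the sense defined in the context) to the continuous generalized exchange-driven growth equation with kernel $\mathcal{A}$ and initial condition $\zeta^{in}$ satisfies, for all $t>0$, $$\int_0^\infty x\,\zeta(t,x)\,dx=\int_0^\infty x\,\zeta^{in}(x)\,dx .$$
   Context: $\mathbb{R}_{>0}=(0,\infty)$, and $L^1_{0,1}=L^1(\mathbb{R}_{>0},(1+x)\,dx)$ with its standard norm. $\mathcal{C}([0,\infty),w\text{-}L^1(\mathbb{R}_{>0}))$ is the set of functions from $[0,\infty)$ to $L^1(\mathbb{R}_{>0})$ that are continuous for the weak topology of $L^1(\mathbb{R}_{>0})$. The continuous generalized exchange-driven growth equation is, for $x>0$, $t\ge0$, $$\begin{aligned}\partial_t\zeta(t,x)=&\int_0^\infty\!\!\int_0^\infty \mathcal{A}(x+z,y;z)\zeta(t,x+z)\zeta(t,y)\,dy\,dz-\int_0^\infty\!\!\int_z^\infty \mathcal{A}(y,x;z)\zeta(t,y)\zeta(t,x)\,dy\,dz\\&+\int_0^x\!\!\int_z^\infty \mathcal{A}(y,x-z;z)\zeta(t,y)\zeta(t,x-z)\,dy\,dz-\int_0^x\!\!\int_0^\infty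 \mathcal{A}(x,y;z)\zeta(t,x)\zeta(t,y)\,dy\,dz,\end{aligned}$$ with $\zeta(0,x)=\zeta^{in}(x)\ge 0$ a.e. Weak solution: given $0\le\zeta^{in}\in L^1_{0,1}$, a function $\zeta$ is a weak solution if (a) $0\le\zeta\in\mathcal{C}([0,\infty),w\text{-}L^1(\mathbb{R}_{>0}))\cap L^\infty(0,T;L^1_{0,1})$ for every $T>0$; and (b) for every $t\ge0$ and every smooth $\omega\in L^\infty(\mathbb{R}_{>0})$, $$\int_0^\infty\omega(x)[\zeta(t,x)-\zeta^{in}(x)]\,dx=\int_0^t\int_0^\infty\int_0^\infty\int_0^x\tilde\omega(x,y,z)\,\mathcal{A}(x,y;z)\,\zeta(s,x)\,\zeta(s,y)\,dz\,dy\,dx\,ds,$$ where $\tilde\omega(x,y,z)=\omega(y+z)+\omega(x-z)-\omega(x)-\omega(y)$. *)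

(* Defs.v *)
From HB Require Import structures.
From mathcomp Require Import all_boot all_order all_algebra.
From mathcomp Require Import all_classical all_reals all_analysis.
Set Implicit Arguments.
Unset Strict Implicit.
Unset Printing Implicit Defensive.
Import Order.TTheory GRing.Theory Num.Theory.
Import numFieldNormedType.Exports.
Local Open Scope classical_set_scope.
Local Open Scope ring_scope.

(* Elements of function spaces on (0, +oo) are given by representatives R -> R,
   measurable on Rpos, whose values outside Rpos are irrelevant. *)

Definition Rpos (R : realType) : set R := `]0, +oo[.
Arguments Rpos {R}.

Definition ae_nonneg (R : realType) (f : R -> R) : Prop :=
  {ae @lebesgue_measure R, forall x, Rpos x -> 0 <= f x}.

Definition in_L1 (R : realType) (f : R -> R) : Prop :=
  (@lebesgue_measure R).-integrable Rpos (EFin \o f).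

Definition in_Linfty (R : realType) (f : R -> R) : Prop :=
  measurable_fun Rpos f /\
  exists M : R, {ae @lebesgue_measure R, forall x, Rpos x -> `|f x| <= M}.

Definition norm01 (R : realType) (f : R -> R) : \bar R :=
  (\int[@lebesgue_measure R]_(x in Rpos) ((1 + x) * `|f x|)%:E)%E.

Definition in_L1_01 (R : realType) (f : R -> R) : Prop :=
  measurable_fun Rpos f /\ (norm01 f < +oo)%E.

(* The bounded linear functionals on L^1(0, +oo). Boundedness makes l insensitive
   to the choice of representatives; the values of l outside L^1 are irrelevant. *)
Definition L1_dual (R : realType) (l : (R -> R) -> R) : Prop :=
  (forall (a : R) (f g : R -> R), in_L1 f -> in_L1 g ->
     l (fun x => a * f x + g x) = a * l f + l g) /\
  (exists C : R, forall f : R -> R, in_L1 f ->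
     (`|l f|%:E <=
      C%:E * \int[@lebesgue_measure R]_(x in Rpos) `|f x|%:E)%E).

(* C([0, +oo), w-L^1(0, +oo)): the weak topology is the initial topology for
   the dual of L^1, so continuity is tested on the functionals of the dual. *)
Definition weakly_continuous_L1 (R : realType) (u : R -> R -> R) : Prop :=
  (forall t, 0 <= t -> in_L1 (u t)) /\
  (forall l : (R -> R) -> R, L1_dual l ->
     {within `[0, +oo[, continuous (fun t => l (u t))}).

Definition simple_L1_01 (R : realType) (s : R -> R -> R) : Prop :=
  exists (n : nat) (E : 'I_n -> set R) (g : 'I_n -> R -> R),
    [/\ forall i, measurable (E i),
        forall i, in_L1_01 (g i)
      & forall t x, s t x = \sum_(i < n) \1_(E i) t * g i x].

(* The Bochner space L^oo(0, T; L^1_{0,1}): essentially bounded and strongly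
   measurable, i.e. a.e. limit in norm of simple functions. *)
Definition in_Linfty_L1_01 (R : realType) (T : R) (u : R -> R -> R) : Prop :=
  [/\ {ae @lebesgue_measure R, forall t, 0 < t < T -> in_L1_01 (u t)},
      exists s : nat -> R -> R -> R, (forall n, simple_L1_01 (s n)) /\
        {ae @lebesgue_measure R, forall t, 0 < t < T ->
          norm01 (fun x => s n t x - u t x) @[n --> \oo] --> 0%E}
    & exists M : R, {ae @lebesgue_measure R, forall t, 0 < t < T ->
          (norm01 (u t) <= M%:E)%E}].

(* C^oo on the open set (0, +oo); derivability at x > 0 is a local property, so
   the values of f outside Rpos play no role. *)
Definition smooth_on_Rpos (R : realType) (f : R -> R) : Prop :=
  forall (n : nat) (x : R), Rpos x -> derivable (derive1n n f) x 1.

Definition omega_tilde (R : realType) (w : R -> R) (x y z : R) : R :=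
  w (y + z) + w (x - z) - w x - w y.

Definition weak_solution (R : realType) (K : R -> R -> R -> R)
    (zeta_in : R -> R) (zeta : R -> R -> R) : Prop :=
  [/\ forall t, 0 <= t -> ae_nonneg (zeta t),
      weakly_continuous_L1 zeta,
      forall T, 0 < T -> in_Linfty_L1_01 T zeta
    & forall (t : R) (w : R -> R), 0 <= t -> smooth_on_Rpos w -> in_Linfty w ->
      (\int[@lebesgue_measure R]_(x in Rpos)
          (w x * (zeta t x - zeta_in x))%:E =
       \int[@lebesgue_measure R]_(s in `[0%R, t])
       \int[@lebesgue_measure R]_(x in Rpos)
       \int[@lebesgue_measure R]_(y in Rpos)
       \int[@lebesgue_measure R]_(z in `]0%R, x[)
          (omega_tilde w x y z * K x y z * zeta s x * zeta s y)%:E)%E].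

(* Main.v *)
Require Import Defs.
From HB Require Import structures.
From mathcomp Require Import all_boot all_order all_algebra.
From mathcomp Require Import all_classical all_reals all_analysis.
From mathcomp Require Import measurable_realfun lra ring.
Set Implicit Arguments.
Unset Strict Implicit.
Unset Printing Implicit Defensive.
Import Order.TTheory GRing.Theory Num.Theory.
Import numFieldNormedType.Exports.
Local Open Scope classical_set_scope.
Local Open Scope ring_scope.

(** The total mass [int x zeta] is formally conserved because every exchange
conserves [x]: for [w x = x] the quantity [omega_tilde w] vanishes. As [w] is
unbounded it is not an admissible test function, so it is replaced by
[sat c x = c * (1 - exp (- x / c))], which is smooth and bounded, increases to
[x] as [c] grows, and is nondecreasing and 1-Lipschitz on the half-line. The
Lipschitz bound gives [`|omega_tilde (sat c) x y z| <= z] uniformly in [c]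
([omega_tilde_sat_le]), and this quantity tends to [0] with [c -> +oo].

On the collision side, away from the line [x + y = 1] the kernel is at most
[A * (1 + x) * (1 + y) * `|phi z|] ([kernel_le]), so the integrand is dominated
by [A * (1 + x) * (1 + y) * (z * `|phi z|) * `|zeta s x| * `|zeta s y|], a
product of integrable functions of [x], [y] and [z], whose integral is bounded
uniformly for almost every [s] between [0] and [t]. Dominated convergence,
applied successively to the four iterated integrals, shows that the collision
term tends to [0] ([cvg_collision_integral]).

On the other side, [zeta t] is known to have a finite first moment only for
almost every [t]. Monotone convergence in the extended reals
([cvg_sat_moment]) sends [int sat c * zeta t] to [int x * zeta t] for every
[t], and since the first moment of [zeta_in] is finite the balance equation
passes to the limit.

Nothing asserts that the inner integrals are measurable functions of the
outer variables, so the usual dominated convergence theorem cannot be chained.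
The way out is that the integral of an arbitrary nonnegative function is a
supremum over the simple functions below it, i.e. its lower integral, and is
therefore attained by a measurable minorant ([measurable_minorant]). When the
limit is [0], the minorants converge to [0] with the same dominating function,
and dominated convergence follows for arbitrary functions
([dominated_cvg_integral0]). *)

(** * Dominated convergence to zero for arbitrary functions *)

Section lower_integral.
Local Open Scope ereal_scope.
Context d (T : measurableType d) (R : realType).
Variables (mu : {measure set T -> \bar R}) (D : set T) (mD : measurable D).

Import HBNNSimple.

(** The supremum of a maximizing sequence of simple functions below [f] is
measurable, is still below [f], and carries the whole integral. *)
Lemma ge0_measurable_minorant (f : T -> \bar R) :
  (forall x, D x -> 0 <= f x) ->
  exists h : T -> \bar R, [/\ measurable_fun D h,
    forall x, D x -> 0 <= h x <= f x
    & \int[mu]_(x in D) f x <= \int[mu]_(x in D) h x].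
Proof.
move=> f0.
pose S := [set sintegral mu h |
  h in [set h : {nnsfun T >-> R} | forall x, (h x)%:E <= (f \_ D) x]].
have -> : \int[mu]_(x in D) f x = ereal_sup S by rewrite ge0_integralE.
have S0 : S != set0.
  apply/set0P; exists (sintegral mu (@nnsfun0 _ T R)); exists nnsfun0 => // x.
  by rewrite /patch; case: ifPn => //; rewrite inE => /f0.
have [u Su cu] := ereal_sup_seq S0.
have /choice[v vP] n : exists v : {nnsfun T >-> R},
    (forall x, (v x)%:E <= (f \_ D) x) /\ sintegral mu v = u n.
  by have [v ? <-] := Su n; exists v.
pose h x := esups (fun n => (v n x)%:E) 0%N.
have vh n x : (v n x)%:E <= h x by apply: ereal_sup_ubound; exists n.
have h0 x : 0 <= h x by rewrite (le_trans _ (vh 0%N x))// lee_fin fun_ge0.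
have mh E : measurable_fun E h.
  apply: measurable_fun_esups => n; apply/measurable_EFinP.
  exact: measurable_funTS.
exists h; split => //.
- move=> x Dx; rewrite h0/=; apply: ge_ereal_sup => _ [n _ <-].
  by have := (vP n).1 x; rewrite patchE mem_set.
- rewrite -(cvg_lim _ cu)//; apply: lime_le.
    by apply/cvg_ex; exists (ereal_sup S).
  apply: nearW => n; rewrite -(vP n).2 -integralT_nnsfun [leRHS]integral_mkcond.
  apply: ge0_le_integral => //.
  + by move=> x _; rewrite lee_fin fun_ge0.
  + by apply/measurable_EFinP; exact: measurable_funTS.
  + by apply/(measurable_restrict _ mD measurableT); rewrite setTI; exact: mh.
  + move=> x _; have := (vP n).1 x; rewrite !patchE; case: ifPn => //.
Qed.

(** The positive and negative parts are treated separately: the modulus of a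
difference of two nonnegative numbers is at most their maximum, which the
maximum of the two minorants controls. *)
Lemma measurable_minorant (f : T -> \bar R) :
  exists h : T -> \bar R, [/\ measurable_fun D h,
    forall x, D x -> 0 <= h x <= `|f x|
    & `|\int[mu]_(x in D) f x| <= \int[mu]_(x in D) h x].
Proof.
have fpos x : f^\+ x <= `|f x|.
  by have /(congr1 (@^~ x))/= -> := fune_abse f; rewrite leeDl.
have fneg x : f^\- x <= `|f x|.
  by have /(congr1 (@^~ x))/= -> := fune_abse f; rewrite leeDr.
have [hp [mhp hpf Ihp]] := @ge0_measurable_minorant f^\+ (fun x _ => funepos_ge0 f x).
have [hn [mhn hnf Ihn]] := @ge0_measurable_minorant f^\- (fun x _ => funeneg_ge0 f x).
have hp0 x : D x -> 0 <= hp x by move=> /hpf/andP[].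
have hn0 x : D x -> 0 <= hn x by move=> /hnf/andP[].
exists (fun x => maxe (hp x) (hn x)); split.
- exact: measurable_maxe.
- move=> x Dx; rewrite le_max hp0//= ge_max.
  have /andP[_ /le_trans->//] := hpf _ Dx.
  by have /andP[_ /le_trans->//] := hnf _ Dx.
- have ip : \int[mu]_(x in D) f^\+ x <= \int[mu]_(x in D) maxe (hp x) (hn x).
    apply: le_trans Ihp _; apply: ge0_le_integral => //.
      exact: measurable_maxe.
    by move=> x Dx; rewrite le_max lexx.
  have inn : \int[mu]_(x in D) f^\- x <= \int[mu]_(x in D) maxe (hp x) (hn x).
    apply: le_trans Ihn _; apply: ge0_le_integral => //.
      exact: measurable_maxe.
    by move=> x Dx; rewrite le_max lexx orbT.
  rewrite integralE.
  have: 0 <= \int[mu]_(x in D) f^\+ x by apply: integral_ge0.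
  have: 0 <= \int[mu]_(x in D) f^\- x by apply: integral_ge0.
  move: ip inn.
  case: (\int[mu]_(x in D) maxe (hp x) (hn x)) => [r| |]; last 2 first.
  + by move=> *; rewrite leey.
  + by move=> h _ _ /le_trans/(_ h).
  case: (\int[mu]_(x in D) f^\+ x) => [a| |]//.
  case: (\int[mu]_(x in D) f^\- x) => [b| |]//.
  rewrite !lee_fin/= => ar br b0 a0; rewrite ler_norml.
  apply/andP; split; lra.
Qed.

Lemma le_abse_integral_ae (f g : T -> \bar R) :
  measurable_fun D g -> (forall x, D x -> 0 <= g x) ->
  {ae mu, forall x, D x -> `|f x| <= g x} ->
  `|\int[mu]_(x in D) f x| <= \int[mu]_(x in D) g x.
Proof.
move=> mg g0 fg; have [h [mh hf /le_trans->//]] := measurable_minorant f.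
apply: ae_ge0_le_integral => //; first by move=> x /hf/andP[].
apply: filterS fg => x fg Dx; have /andP[_ /le_trans->//] := hf _ Dx.
exact: fg.
Qed.

(** Measurable minorants of the [`|f n|] inherit both the domination by [g] and
the convergence to [0]; a nonzero limit could not be treated in this way. *)
Lemma dominated_cvg_integral0 (f : (T -> \bar R)^nat) (g : T -> \bar R) :
  mu.-integrable D g ->
  {ae mu, forall x, D x -> f ^~ x @ \oo --> 0} ->
  {ae mu, forall x n, D x -> `|f n x| <= g x} ->
  \int[mu]_(x in D) f n x @[n --> \oo] --> 0.
Proof.
move=> ig f0 fg.
have /choice[h hP] n := measurable_minorant (f n).
have hge0 n x : D x -> 0 <= h n x by move=> Dx; have [_ /(_ _ Dx)/andP[]] := hP n.
have hlef n x : D x -> h n x <= `|f n x|.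
  by move=> Dx; have [_ /(_ _ Dx)/andP[]] := hP n.
have [//|||||_ _] := @dominated_convergence _ _ _ mu _ mD h (cst 0) g.
- by move=> n; have [] := hP n.
- exact: measurable_cst.
- apply: filterS f0 => x f0 Dx.
  apply: (@squeeze_cvge _ _ _ _ (cst 0) _ (fun n => `|f n x|)).
  + by apply: nearW => n; rewrite hge0//= hlef.
  + exact: cvg_cst.
  + by apply/cvg_abse0P; exact: f0.
- exact: ig.
- apply: filterS fg => x fg n Dx.
  by rewrite gee0_abs ?hge0// (le_trans (hlef _ _ Dx))// fg.
rewrite integral0 => hc; apply/cvg_abse0P.
apply: squeeze_cvge (cvg_cst 0) hc; apply: nearW => n.
by rewrite abse_ge0/=; have [] := hP n.
Qed.

End lower_integral.

(** * Saturated identity as test function *)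

(** A smooth, bounded, concave and nondecreasing substitute for the identity on
the half-line, with slope at most 1 and saturation level [c]. *)
Definition sat (R : realType) (c x : R) : R := c * (1 - expR (- (x / c))).

Section saturation.
Variables (R : realType) (c : R).
Hypothesis c0 : 0 < c.

Lemma sat0 : sat c 0 = 0.
Proof. by rewrite /sat mul0r oppr0 expR0 subrr mulr0. Qed.

Lemma sat_le_bound x : sat c x <= c.
Proof. by rewrite /sat ger_pMr// gerBl expR_ge0. Qed.

Lemma sat_incr_ge0 x y : x <= y -> 0 <= sat c y - sat c x.
Proof.
move=> xy; rewrite -mulrBr mulr_ge0 ?(ltW c0)//.
suff : expR (- (y / c)) <= expR (- (x / c)) by lra.
by rewrite ler_expR lerN2 ler_pM2r ?invr_gt0.
Qed.

Lemma sat_incr_le x y : 0 <= x <= y -> sat c y - sat c x <= y - x.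
Proof.
move=> /andP[x0 xy]; rewrite -mulrBr.
have -> : y - x = c * ((y - x) / c) by field; rewrite gt_eqF.
rewrite ler_pM2l// (_ : - (y / c) = - (x / c) + - ((y - x) / c)); last by ring.
rewrite expRD; have u0 : 0 <= (y - x) / c by rewrite divr_ge0 ?(ltW c0)// subr_ge0.
have := expR_ge1Dx (- ((y - x) / c)).
have : expR (- (x / c)) <= 1 by rewrite -expR0 ler_expR oppr_le0 divr_ge0// ltW.
have := expR_gt0 (- (x / c)).
move: u0; set u := (y - x) / c; set p := expR (- (x / c)); set q := expR (- u).
move=> u0 p0 p1 qu.
have : 0 <= p * (u - (1 - q)) by rewrite mulr_ge0 ?(ltW p0)//; lra.
have : 0 <= u * (1 - p) by rewrite mulr_ge0// subr_ge0.
by lra.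
Qed.

Lemma sat_ge0 x : 0 <= x -> 0 <= sat c x.
Proof. by move=> /sat_incr_ge0; rewrite sat0 subr0. Qed.

Lemma sat_le_id x : 0 <= x -> sat c x <= x.
Proof. by move=> x0; have := @sat_incr_le 0 x; rewrite lexx sat0 !subr0; exact. Qed.

(** With [u = x / c], this follows from [exp u >= 1 + u] and
[(1 + u) * (1 - u + u ^ 2) = 1 + u ^ 3 >= 1]. *)
Lemma sat_ge x : 0 <= x -> x - x ^+ 2 / c <= sat c x.
Proof.
move=> x0; have u0 : 0 <= x / c by rewrite divr_ge0// ltW.
rewrite (_ : x - _ = c * (x / c - (x / c) ^+ 2)); last by field; rewrite gt_eqF.
rewrite ler_pM2l// expRN.
have := expR_ge1Dx (x / c); move: (expR_gt0 (x / c)).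
move: u0; set u := x / c; set p := expR u => u0 p0 pu.
rewrite -(ler_pM2r p0) [leRHS]mulrBl mul1r mulVf ?gt_eqF//.
have : 0 <= (p - (1 + u)) * (1 - u + u ^+ 2).
  by rewrite mulr_ge0// ?subr_ge0//; nra.
have : 0 <= u ^+ 3 by rewrite exprn_ge0.
by lra.
Qed.

(** Monotonicity in the level is the convexity of [exp] between [- x / c] and
[0], with weight [c / b]. *)
Lemma sat_le b x : c <= b -> 0 <= x -> sat c x <= sat b x.
Proof.
move=> cb x0; have b0 : 0 < b by exact: lt_le_trans cb.
have r0 : 0 <= c / b by rewrite divr_ge0// ltW.
have r1 : c / b <= 1 by rewrite ler_pdivrMr// mul1r.
have := convex_expR (Itv01 r0 r1) (- (x / c)) 0.
rewrite !convRE/= mulr0 addr0 expR0 mulr1.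
rewrite (_ : c / b * - (x / c) = - (x / b)); last first.
  by field; rewrite !gt_eqF.
rewrite /unstable.onem /sat => h.
have -> : c * (1 - expR (- (x / c))) = b * (c / b * (1 - expR (- (x / c)))).
  by field; rewrite gt_eqF.
by rewrite ler_pM2l//; lra.
Qed.

Let is_derive_exp (a k x : R) :
  is_derive x 1 (fun y : R => a + k * expR (- c^-1 * y))
    (k * - c^-1 * expR (- c^-1 * x)).
Proof.
apply: is_derive_eq.
rewrite /GRing.scale/=; ring.
Qed.

(** The functions [a + k * exp (- x / c)] are stable under derivation. *)
Lemma derive1n_sat n : exists a k : R,
  derive1n n (sat c) = fun x => a + k * expR (- c^-1 * x).
Proof.
elim: n => [|n [a [k IH]]].
  exists c, (- c); apply/funext => x /=; rewrite /sat.
  by rewrite mulrBr mulr1 mulNr (mulrC x) mulNr.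
exists 0, (k * - c^-1); rewrite derive1nS IH; apply/funext => x; rewrite derive1E.
by have [_ ->] := is_derive_exp a k x; rewrite add0r.
Qed.

Lemma smooth_sat : smooth_on_Rpos (sat c).
Proof.
by move=> n x _; have [a [k ->]] := derive1n_sat n; have [] := is_derive_exp a k x.
Qed.

End saturation.

Lemma cvg_sat (R : realType) (x : R) : 0 <= x -> sat n.+1%:R x @[n --> \oo] --> x.
Proof.
move=> x0.
have l : x - x ^+ 2 * harmonic n @[n --> \oo] --> x.
  rewrite -[X in _ --> X]subr0 -[X in _ --> _ - X](mulr0 (x ^+ 2)).
  apply: cvgB; first exact: cvg_cst.
  by apply: cvgM; [exact: cvg_cst|exact: cvg_harmonic].
apply: (@squeeze_cvgr _ _ _ _ (fun n => x - x ^+ 2 * harmonic n)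
  (cst x)) => //; last exact: cvg_cst.
by apply: nearW => n; rewrite sat_ge// sat_le_id.
Qed.

(** * Cancellation along one exchange *)

Section collision.
Variables (R : realType) (c : R).
Hypothesis c0 : 0 < c.

(** [omega_tilde] is the difference of the increments of [sat c] over
[[y, y + z]] and over [[x - z, x]], and each of them lies in [[0, z]]. *)
Lemma omega_tilde_sat_le x y z : 0 <= y -> 0 <= z -> z <= x ->
  `|omega_tilde (sat c) x y z| <= z.
Proof.
move=> y0 z0 zx; have xz0 : 0 <= x - z by rewrite subr_ge0.
have yyz : y <= y + z by rewrite lerDl.
have xzx : x - z <= x by rewrite gerBl.
have := sat_incr_ge0 c0 yyz; have := sat_incr_ge0 c0 xzx.
have := @sat_incr_le _ _ c0 y (y + z); rewrite y0 yyz => /(_ isT).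
have := @sat_incr_le _ _ c0 (x - z) x; rewrite xz0 xzx => /(_ isT).
rewrite /omega_tilde => h1 h2 h3 h4; rewrite ler_norml; apply/andP; split; lra.
Qed.

End collision.

Lemma cvg_omega_tilde_sat (R : realType) (x y z : R) :
  0 <= y -> 0 <= z -> z <= x ->
  omega_tilde (sat n.+1%:R) x y z @[n --> \oo] --> 0.
Proof.
move=> y0 z0 zx; have x0 : 0 <= x := le_trans z0 zx.
rewrite (_ : 0 = (y + z) + (x - z) - x - y); last by ring.
by apply: cvgB; [apply: cvgB; [apply: cvgD|]|];
  apply: cvg_sat; rewrite ?subr_ge0// addr_ge0.
Qed.

(** * Weighted integrability and first moments *)

Section moments.
Variable R : realType.
Local Notation mu := (@lebesgue_measure R).
Implicit Types f : R -> R.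

Lemma measurable_Rpos : measurable (@Rpos R).
Proof. exact: measurable_itv. Qed.

Lemma ae_neq (a : R) : {ae mu, forall x, x != a}.
Proof.
exists [set a]; split => //; first exact: lebesgue_measure_set1.
by move=> x /= /negP; rewrite negbK => /eqP.
Qed.

Lemma ae_imply (P Q : R -> Prop) : (forall x, P x -> Q x) ->
  {ae mu, forall x, P x} -> {ae mu, forall x, Q x}.
Proof. by move=> PQ; apply: filterS; first exact: (ae_filter_ringOfSetsType mu). Qed.

Lemma in_L1_01_measurable_weighted f : measurable_fun Rpos f ->
  measurable_fun Rpos (fun x => (1 + x) * `|f x|).
Proof.
move=> mf; apply: measurable_funM; last exact: measurableT_comp.
by apply: measurable_funD => //; exact: measurable_cst.
Qed.

Lemma in_L1_01_integrable f : in_L1_01 f ->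
  mu.-integrable Rpos (EFin \o (fun x => (1 + x) * `|f x|)).
Proof.
move=> [mf foo]; apply/integrableP; split.
  by apply/measurable_EFinP; exact: in_L1_01_measurable_weighted.
apply: le_lt_trans foo; rewrite le_eqVlt; apply/orP; left; apply/eqP.
apply: eq_integral => x; rewrite inE /Rpos/= in_itv/= andbT => x0.
by rewrite ger0_norm// mulr_ge0// addr_ge0// ltW.
Qed.

Lemma in_L1_01_moment f : in_L1_01 f ->
  mu.-integrable Rpos (EFin \o (fun x => x * f x)).
Proof.
move=> f01; have [mf _] := f01.
apply: le_integrable (in_L1_01_integrable f01); first exact: measurable_Rpos.
  by apply/measurable_EFinP; apply: measurable_funM.
move=> x; rewrite /Rpos/= in_itv/= andbT => x0.
rewrite lee_fin !normrM normr_id ler_wpM2r// !ger0_norm ?addr_ge0 ?(ltW x0)//.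
by rewrite lerDr.
Qed.

Lemma in_L1_01_in_L1 f : in_L1_01 f -> in_L1 f.
Proof.
move=> f01; have [mf _] := f01.
apply: le_integrable (in_L1_01_integrable f01); first exact: measurable_Rpos.
  exact/measurable_EFinP.
move=> x; rewrite /Rpos/= in_itv/= andbT => x0.
rewrite lee_fin normrM normr_id ler_peMl// ger0_norm ?addr_ge0 ?(ltW x0)//.
by rewrite lerDl ltW.
Qed.

Lemma measurable_sat (c : R) D : measurable_fun D (sat c).
Proof.
apply: measurable_funM; first exact: measurable_cst.
apply: measurable_funB; first exact: measurable_cst.
apply: measurableT_comp => //; apply: measurableT_comp => //.
by apply: measurable_funM => //; exact: measurable_cst.
Qed.

Lemma norm_sat_le (c x : R) : 0 < c -> 0 <= x -> `|sat c x| <= c.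
Proof. by move=> c0 x0; rewrite ger0_norm ?sat_ge0// sat_le_bound. Qed.

Lemma in_Linfty_sat (c : R) : 0 < c -> in_Linfty (sat c).
Proof.
move=> c0; split; first exact: measurable_sat.
exists c; apply: aeW => x; rewrite /Rpos/= in_itv/= andbT => x0.
by rewrite norm_sat_le// ltW.
Qed.

Lemma integrable_sat (c : R) f : 0 < c -> in_L1 f ->
  mu.-integrable Rpos (EFin \o (fun x => sat c x * f x)).
Proof.
move=> c0 fL1; have mf : measurable_fun Rpos f.
  by apply/measurable_EFinP; exact: measurable_int fL1.
apply: (@le_integrable _ _ _ mu Rpos _ _ (EFin \o (fun x => c * f x))).
- exact: measurable_Rpos.
- by apply/measurable_EFinP; apply: measurable_funM => //; exact: measurable_sat.
- move=> x; rewrite /Rpos/= in_itv/= andbT => x0.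
  rewrite lee_fin (normrM (sat c x)) (normrM c (f x)) ler_wpM2r//.
  by rewrite (ger0_norm (ltW c0)) norm_sat_le// ltW.
- by apply: integrableZl fL1; exact: measurable_Rpos.
Qed.

(** Monotone convergence: the limit may be [+oo], so that this applies to [f] in
[L1] with no control of its first moment. *)
Lemma cvg_sat_moment f : measurable_fun Rpos f -> ae_nonneg f ->
  (\int[mu]_(x in Rpos) (sat n.+1%:R x * f x)%:E @[n --> \oo] -->
   \int[mu]_(x in Rpos) (x * f x)%:E)%E.
Proof.
move=> mf f0; have mR := measurable_Rpos.
have mg (g : R -> R) : measurable_fun Rpos g ->
    (\int[mu]_(x in Rpos) (g x * f x)%:E =
     \int[mu]_(x in Rpos) (g x * `|f x|)%:E)%E.
  move=> mg; apply: ae_eq_integral => //.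
  - by apply/measurable_EFinP; exact: measurable_funM.
  - apply/measurable_EFinP; apply: measurable_funM => //.
    exact: measurableT_comp.
  - apply: ae_imply f0 => x f0 x0.
    by rewrite ger0_norm// f0.
(* monotone convergence requires nonnegativity everywhere, hence `|f| *)
rewrite (mg (fun x => x))//.
rewrite (_ : (fun n => _) =
    (fun n => \int[mu]_(x in Rpos) (sat n.+1%:R x * `|f x|)%:E)%E); last first.
  by apply/funext => n; apply: mg; exact: measurable_sat.
have cv x : Rpos x -> ((sat n.+1%:R x * `|f x|)%:E @[n --> \oo] --> (x * `|f x|)%:E)%E.
  rewrite /Rpos/= in_itv/= andbT => x0.
  apply: cvg_EFin; first exact: nearW.
  by apply: cvgM; [apply: cvg_sat; exact: ltW|exact: cvg_cst].
have -> : (\int[mu]_(x in Rpos) (x * `|f x|)%:E =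
    \int[mu]_(x in Rpos) limn (fun n => (sat n.+1%:R x * `|f x|)%:E))%E.
  apply: eq_integral => x; rewrite inE => x0.
  by apply/esym/cvg_lim => //; exact: cv.
apply: cvg_monotone_convergence => //.
- move=> n; apply/measurable_EFinP; apply: measurable_funM.
    exact: measurable_sat.
  exact: measurableT_comp.
- move=> n x; rewrite /Rpos/= in_itv/= andbT => x0.
  by rewrite lee_fin mulr_ge0// sat_ge0// ltW.
- move=> x; rewrite /Rpos/= in_itv/= andbT => x0 m n mn.
  by rewrite lee_fin ler_wpM2r// sat_le ?ler_nat// ltW.
Qed.

End moments.

(** * Vanishing of the collision term *)

(** The uniform bound and the convergence are kept together because integrating
in one variable turns them into the same pair for the next variable. *)
Definition dominated_null (R : realType) (u : (\bar R)^nat) (b : R) : Prop :=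
  (forall n, (`|u n| <= b%:E)%E) /\ u @ \oo --> 0%E.

Section dominated_null_integral.
Context d (T : measurableType d) (R : realType).
Variables (mu : {measure set T -> \bar R}) (D : set T) (mD : measurable D).

Lemma dominated_null_integral (f : (T -> \bar R)^nat) (g : T -> R) (k B : R) :
  mu.-integrable D (EFin \o g) -> (forall x, D x -> 0 <= g x) -> 0 <= k ->
  (\int[mu]_(x in D) (g x)%:E <= B%:E)%E ->
  {ae mu, forall x, D x -> dominated_null (f ^~ x) (k * g x)} ->
  dominated_null (fun n => \int[mu]_(x in D) f n x)%E (k * B).
Proof.
move=> ig g0 k0 gB fg.
have ikg : mu.-integrable D (fun x => (k * g x)%:E) by exact: integrableZl ig.
split.
- move=> n; apply: (@le_trans _ _ (\int[mu]_(x in D) (k * g x)%:E)%E).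
    apply: le_abse_integral_ae => //.
    + exact: measurable_int ikg.
    + by move=> x Dx; rewrite lee_fin mulr_ge0// g0.
    + by apply: filterS fg => x fg Dx; have [] := fg Dx.
  under eq_integral do rewrite EFinM.
  by rewrite integralZl// EFinM lee_wpmul2l.
- apply: (dominated_cvg_integral0 mD ikg).
  + by apply: filterS fg => x fg Dx; have [] := fg Dx.
  + by apply: filterS fg => x fg n Dx; have [] := fg Dx.
Qed.

End dominated_null_integral.

Section collision_integral.
Variables (R : realType) (phi : R -> R) (K : R -> R -> R -> R) (A : R).
Local Notation mu := (@lebesgue_measure R).
Hypothesis phi_L1_01 : in_L1_01 phi.
Hypothesis K_ge0 : forall x y z, Rpos x -> Rpos y -> Rpos z -> 0 <= K x y z.
Hypothesis A_ge0 : 0 <= A.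
Hypothesis K_le_small : forall x y z, Rpos x -> Rpos y -> Rpos z ->
  x + y < 1 -> K x y z <= A * phi z.
Hypothesis K_le_large : forall x y z, Rpos x -> Rpos y -> Rpos z ->
  1 < x + y -> K x y z <= A * (x + y) * phi z.

(** Both growth regimes are covered by [(1 + x) * (1 + y)], a product, so that
the integrals in [x] and [y] separate; on the line [x + y = 1] the kernel is
uncontrolled. *)
Lemma kernel_le x y z : Rpos x -> Rpos y -> Rpos z -> y != 1 - x ->
  `|K x y z| <= A * (1 + x) * (1 + y) * `|phi z|.
Proof.
move=> px py pz yx; rewrite ger0_norm ?K_ge0//.
move: (px) (py) (pz); rewrite /Rpos/= !in_itv/= !andbT => x0 y0 z0.
have xy1 : 1 <= (1 + x) * (1 + y) by nra.
have xy2 : x + y <= (1 + x) * (1 + y) by nra.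
rewrite -[A * _ * _]mulrA.
have [xy|xy|xy] := ltgtP (x + y) 1.
- apply: (le_trans (K_le_small px py pz xy)).
  rewrite (le_trans (ler_wpM2l A_ge0 (ler_norm _)))// ler_wpM2r// ler_peMr//.
- apply: (le_trans (K_le_large px py pz xy)).
  rewrite (@le_trans _ _ (A * (x + y) * `|phi z|))//.
    by rewrite ler_wpM2l ?ler_norm// mulr_ge0// addr_ge0// ltW.
  by rewrite ler_wpM2r// ler_wpM2l.
- by move: yx; rewrite -xy addrAC subrr add0r eqxx.
Qed.

Let M := fine (\int[mu]_(z in Rpos) (z * `|phi z|)%:E)%E.

Let norm_phi_L1_01 : in_L1_01 (fun z => `|phi z|).
Proof.
have [mphi nphi] := phi_L1_01; split; first exact: measurableT_comp.
by rewrite /norm01; under eq_integral do rewrite normr_id.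
Qed.

Let iphi : mu.-integrable Rpos (EFin \o (fun z => z * `|phi z|)).
Proof. exact: in_L1_01_moment. Qed.

Let phi0 z : Rpos z -> 0 <= z * `|phi z|.
Proof. by rewrite /Rpos/= in_itv/= andbT => z0; rewrite mulr_ge0// ltW. Qed.

Let M_ge0 : 0 <= M.
Proof. by apply: fine_ge0; apply: integral_ge0 => z z0; rewrite lee_fin phi0. Qed.

Lemma dominated_null_z x y a b : Rpos x -> Rpos y -> y != 1 - x ->
  dominated_null (fun n => \int[mu]_(z in `]0%R, x[)
      (omega_tilde (sat n.+1%:R) x y z * K x y z * a * b)%:E)%E
    (A * (1 + x) * (1 + y) * `|a| * `|b| * M).
Proof.
move=> px py yx; have sR : `]0, x[ `<=` @Rpos R.
  by move=> z; rewrite /Rpos/= !in_itv/= => /andP[-> _].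
move: (px) (py); rewrite /Rpos/= !in_itv/= !andbT => x0 y0.
apply: (@dominated_null_integral _ _ R mu _ _ _ (fun z => z * `|phi z|)).
- exact: measurable_itv.
- by apply: integrableS iphi => //; exact: measurable_itv.
- by move=> z /sR; exact: phi0.
- by rewrite !mulr_ge0// addr_ge0// ltW.
- rewrite /M fineK; last first.
  by have := integrable_fin_num _ iphi; apply; exact: measurable_Rpos.
  apply: ge0_subset_integral => //.
  + exact: measurable_itv.
  + exact: measurable_int iphi.
- apply: aeW => z zx; have pz := sR _ zx.
  move: zx => /=; rewrite in_itv/= => /andP[z0 zx].
  split.
  + move=> n; rewrite lee_fin !normrM.
    have := omega_tilde_sat_le (ltr0Sn R n) (ltW y0) (ltW z0) (ltW zx).
    have := kernel_le px py pz yx.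
    set w := `|omega_tilde _ _ _ _|; set k := `|K x y z| => kle wle.
    rewrite [leRHS](_ : _ = z * (A * (1 + x) * (1 + y) * `|phi z|) * `|a| * `|b|);
      last by ring.
    rewrite ler_wpM2r// ler_wpM2r// ler_pM//; exact: normr_ge0.
  + apply: cvg_EFin; first exact: nearW.
    rewrite (_ : 0 = 0 * K x y z * a * b); last by rewrite !mul0r.
    apply: cvgM; last exact: cvg_cst.
    apply: cvgM; last exact: cvg_cst.
    apply: cvgM; last exact: cvg_cst.
    by apply: cvg_omega_tilde_sat; exact: ltW.
Qed.

(** For fixed [x] the uncontrolled line [x + y = 1] is the single point
[y = 1 - x], which the integral in [y] ignores. *)
Lemma dominated_null_y f N x a : in_L1_01 f -> (norm01 f <= N%:E)%E -> Rpos x ->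
  dominated_null (fun n => \int[mu]_(y in Rpos) \int[mu]_(z in `]0%R, x[)
      (omega_tilde (sat n.+1%:R) x y z * K x y z * a * f y)%:E)%E
    (A * (1 + x) * `|a| * M * N).
Proof.
move=> f01 fN px; move: (px); rewrite /Rpos/= in_itv/= andbT => x0.
apply: (@dominated_null_integral _ _ R mu _ _ _ (fun y => (1 + y) * `|f y|)).
- exact: measurable_itv.
- exact: in_L1_01_integrable.
- move=> y; rewrite /Rpos/= in_itv/= andbT => y0.
  by rewrite mulr_ge0// addr_ge0// ltW.
- by rewrite !mulr_ge0// addr_ge0// ltW.
- exact: fN.
- apply: ae_imply (ae_neq (1 - x)) => y yx py.
  rewrite [X in dominated_null _ X](_ : _ = A * (1 + x) * (1 + y) * `|a| * `|f y| * M).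
    exact: dominated_null_z.
  by ring.
Qed.

Lemma dominated_null_x f N : in_L1_01 f -> (norm01 f <= N%:E)%E -> 0 <= N ->
  dominated_null (fun n =>
      \int[mu]_(x in Rpos) \int[mu]_(y in Rpos) \int[mu]_(z in `]0%R, x[)
      (omega_tilde (sat n.+1%:R) x y z * K x y z * f x * f y)%:E)%E
    (A * M * N * N).
Proof.
move=> f01 fN N0.
apply: (@dominated_null_integral _ _ R mu _ _ _ (fun y => (1 + y) * `|f y|)).
- exact: measurable_itv.
- exact: in_L1_01_integrable.
- move=> y; rewrite /Rpos/= in_itv/= andbT => y0.
  by rewrite mulr_ge0// addr_ge0// ltW.
- by rewrite !mulr_ge0.
- exact: fN.
- apply: aeW => x px.
  rewrite [X in dominated_null _ X](_ : _ = A * (1 + x) * `|f x| * M * N).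
    exact: dominated_null_y.
  by ring.
Qed.

Lemma cvg_collision_integral (zeta : R -> R -> R) t : 0 < t ->
  in_Linfty_L1_01 t zeta ->
  (\int[mu]_(s in `[0%R, t]) \int[mu]_(x in Rpos)
     \int[mu]_(y in Rpos) \int[mu]_(z in `]0%R, x[)
      (omega_tilde (sat n.+1%:R) x y z * K x y z * zeta s x * zeta s y)%:E
   @[n --> \oo] --> 0)%E.
Proof.
move=> t0 [z01 _ [C zC]]; pose N := Num.max C 0.
have N0 : 0 <= N by rewrite le_max lexx orbT.
have mI : (mu `[0%R, t] = t%:E)%E.
  by rewrite lebesgue_measure_itv/= lte_fin t0 sube0.
apply: (@dominated_null_integral _ _ _ mu `[0, t] _ _ (cst 1)
  (A * M * N * N) t _ _ _ _ _).2.
- exact: measurable_itv.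
- apply/integrableP; split.
    by apply/measurable_EFinP; exact: measurable_cst.
  by under eq_integral do rewrite /= normr1; rewrite integral_cst//= mI mul1e ltry.
- by [].
- by rewrite !mulr_ge0.
- by rewrite -[leRHS]mul1e -mI -(integral_cst mu).
- (* the bounds on zeta hold in the open interval only, so the two
     endpoints join the exceptional null set *)
  have zN : {ae mu, forall s, 0 < s < t ->
      in_L1_01 (zeta s) /\ (norm01 (zeta s) <= N%:E)%E}.
    move: z01 zC; apply: filterS2; first exact: (ae_filter_ringOfSetsType mu).
    move=> s z01 zC st; split; first exact: z01.
    by apply: le_trans (zC st) _; rewrite lee_fin le_max lexx.
  have := ae_neq (0 : R); have := ae_neq t; move: zN.
  apply: filterS3; first exact: (ae_filter_ringOfSetsType mu).
  move=> s zN st s0 /=; rewrite in_itv/= mulr1 => /andP[s0' st'].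
  have [|zs zsN] := zN; first by rewrite !lt_neqAle s0' st' st eq_sym s0.
  exact: dominated_null_x.
Qed.

End collision_integral.

(** * Conservation of mass *)

Theorem theorem2p7 (R : realType) (zeta_in phi : R -> R)
    (K : R -> R -> R -> R) (A : R)
    (zeta_in_ge0 : ae_nonneg zeta_in) (zeta_in_L1_01 : in_L1_01 zeta_in)
    (phi_L1_01 : in_L1_01 phi)
    (K_meas : measurable_fun (Rpos `*` Rpos `*` Rpos)
       (fun p : R * R * R => K p.1.1 p.1.2 p.2))
    (K_ge0 : forall x y z, Rpos x -> Rpos y -> Rpos z -> 0 <= K x y z)
    (K_eq0 : forall x y z, Rpos x -> Rpos y -> Rpos z -> x < z -> K x y z = 0)
    (A_ge0 : 0 <= A)
    (K_le_small : forall x y z, Rpos x -> Rpos y -> Rpos z ->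
       x + y < 1 -> K x y z <= A * phi z)
    (K_le_large : forall x y z, Rpos x -> Rpos y -> Rpos z ->
       1 < x + y -> K x y z <= A * (x + y) * phi z)
    (zeta : R -> R -> R) (zeta_sol : weak_solution K zeta_in zeta)
    (t : R) (t_gt0 : 0 < t) :
  (\int[@lebesgue_measure R]_(x in Rpos) (x * zeta t x)%:E =
   \int[@lebesgue_measure R]_(x in Rpos) (x * zeta_in x)%:E)%E.
Proof.
have [zeta_ge0 [zeta_L1 _] zeta_bdd zeta_eq] := zeta_sol.
have t_ge0 := ltW t_gt0.
have zt_L1 := zeta_L1 t t_ge0.
have zin_L1 := in_L1_01_in_L1 zeta_in_L1_01.
have mzt : measurable_fun Rpos (zeta t).
  by apply/measurable_EFinP; exact: measurable_int zt_L1.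
have mzin : measurable_fun Rpos zeta_in := zeta_in_L1_01.1.
pose mu := @lebesgue_measure R.
pose collisions n : \bar R := (\int[mu]_(s in `[0%R, t]) \int[mu]_(x in Rpos)
  \int[mu]_(y in Rpos) \int[mu]_(z in `]0%R, x[)
    (omega_tilde (sat n.+1%:R) x y z * K x y z * zeta s x * zeta s y)%:E)%E.
(* both integrals of the difference are finite because sat n.+1 is bounded *)
have balance n : (\int[mu]_(x in Rpos) (sat n.+1%:R x * zeta t x)%:E =
    collisions n + \int[mu]_(x in Rpos) (sat n.+1%:R x * zeta_in x)%:E)%E.
  have c0 : 0 < n.+1%:R :> R by [].
  have izin := integrable_sat c0 zin_L1.
  rewrite /collisions -(zeta_eq _ _ t_ge0 (@smooth_sat _ n.+1%:R) (in_Linfty_sat c0)).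
  under [X in (_ = X + _)%E]eq_integral do rewrite mulrBr EFinB.
  rewrite (integralB_EFin _ (integrable_sat c0 zt_L1) izin)//.
    by rewrite subeK//; apply: integrable_fin_num izin; exact: measurable_Rpos.
  exact: measurable_Rpos.
have fin_in : (\int[mu]_(x in Rpos) (x * zeta_in x)%:E)%E \is a fin_num.
  have := integrable_fin_num _ (in_L1_01_moment zeta_in_L1_01).
  by apply; exact: measurable_Rpos.
have := cvg_sat_moment mzt (zeta_ge0 t t_ge0).
rewrite (_ : (fun n => _) = (fun n => collisions n +
    \int[mu]_(x in Rpos) (sat n.+1%:R x * zeta_in x)%:E)%E); last first.
  by apply/funext => n; exact: balance.
have cvg_rhs : (collisions n +
    \int[mu]_(x in Rpos) (sat n.+1%:R x * zeta_in x)%:E @[n --> \oo] -->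
    0 + \int[mu]_(x in Rpos) (x * zeta_in x)%:E)%E.
  apply: cvgeD; first by rewrite fin_num_adde_defl.
    exact: (cvg_collision_integral phi_L1_01 K_ge0 A_ge0 K_le_small K_le_large
      t_gt0 (zeta_bdd _ t_gt0)).
  exact: cvg_sat_moment.
by move=> /cvg_unique/(_ cvg_rhs) ->//; rewrite add0e.
Qed.
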